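(* Let $\nu$ be a measure with support on the unit circle $\mathbb{T}$ and let $P_n(z)=\sum_{k=0}^{n}b_{k,n}(\nu)z^k$ be the orthonormal polynomials associated with $\nu$. Assume that $\lim_{n\to\infty}\lambda_n(\nu)>0$. Then for every $k\in\mathbb{N}_0$ the limit $\lim_{n\to\infty}b_{n-k,n}(\nu)$ exists.
   Context: $\nu$ is a positive Borel measure on $\mathbb{T}=\{|z|=1\}$; its moment matrix is $\mathbf{T}(\nu)=(c_{i,j})_{i,j=0}^\infty$, $c_{i,j}=\int z^i\overline{z}^j\,d\nu$, and $\lambda_n(\nu)$ is the smallest eigenvalue of $(c_{i,j})_{i,j=0}^n$ (a non-increasing sequence). The matrix is assumed Hermitian positive definite (all truncations have positive determinant). The orthonormal polynomials $P_n$ are orthonormal in $L^2(\nu)$, with $\deg P_n=n$ and leading coefficient $b_{n,n}(\nu)>0$. $\mathbb{N}_0=\{0,1,2,\dots\}$. *)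

(* Defs.v *)
From HB Require Import structures.
From mathcomp Require Import all_boot all_order all_algebra.
From mathcomp Require Import all_classical all_reals all_analysis.
From mathcomp Require Import complex.

Set Implicit Arguments.
Unset Strict Implicit.
Unset Printing Implicit Defensive.

Import Order.TTheory GRing.Theory Num.Theory.
Import numFieldNormedType.Exports.

Local Open Scope classical_set_scope.
Local Open Scope ring_scope.
Local Open Scope complex_scope.

(* R[i] carries no sigma-algebra in the library.  The complex plane is R * R,
   whose (product) sigma-algebra is the Borel one; [toC] reads a point of the
   plane as a complex number. *)
Definition toC (R : realType) (p : R * R) : R[i] := p.1 +i* p.2.

Definition unit_circle (R : realType) : set (R * R) :=
  [set p | `|toC p| = 1].

(* A Borel measure is supported on the closed set [unit_circle] iff it does
   not charge the complement. *)
Definition supported_on_circle (R : realType)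
    (nu : {measure set (R * R)%type -> \bar R}) : Prop :=
  nu (~` @unit_circle R) = 0%E.

Definition Cintegral (R : realType) (nu : {measure set (R * R)%type -> \bar R})
    (f : R[i] -> R[i]) : R[i] :=
  (\int[nu]_p complex.Re (f (toC p)))%R +i*
  (\int[nu]_p complex.Im (f (toC p)))%R.

Definition moment (R : realType) (nu : {measure set (R * R)%type -> \bar R})
    (i j : nat) : R[i] :=
  Cintegral nu (fun z => z ^+ i * (z^*) ^+ j).

(* Indices run over 0, ..., n, hence the size n.+1. *)
Definition moment_mx (R : realType) (nu : {measure set (R * R)%type -> \bar R})
    (n : nat) : 'M[R[i]]_n.+1 :=
  \matrix_(i < n.+1, j < n.+1) moment nu i j.

(* The order on R[i] is partial: x%:C <= a says that a is real and x <= a. *)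
Definition smallest_eigenvalue (R : realType) (n : nat) (A : 'M[R[i]]_n)
    (x : R) : Prop :=
  eigenvalue A x%:C /\ forall a : R[i], eigenvalue A a -> x%:C <= a.

Definition inner_L2 (R : realType) (nu : {measure set (R * R)%type -> \bar R})
    (p q : {poly R[i]}) : R[i] :=
  Cintegral nu (fun z => p.[z] * (q.[z])^*).

(* 0 < x in R[i] means that x is real and positive. *)
Definition orthonormal_polys (R : realType)
    (nu : {measure set (R * R)%type -> \bar R}) (P : nat -> {poly R[i]}) : Prop :=
  (forall n, size (P n) = n.+1 /\ 0 < (P n)`_n) /\
  (forall m n, inner_L2 nu (P m) (P n) = (m == n)%:R).

(* Main.v *)
Require Import Defs.
From HB Require Import structures.
From mathcomp Require Import all_boot all_order all_algebra.
From mathcomp Require Import all_classical all_reals all_analysis.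
From mathcomp Require Import complex measurable_realfun.

(** Write <p, q> for the inner product of L^2(nu), kappa_n > 0 for the leading
    coefficient of P_n, and p^*_n for the reversal z^n conj(p(1 / conj z)), whose
    coefficients are the conjugates of those of p in the opposite order.  The
    coefficient b_{n-k,n} is the conjugate of the k-th coefficient of the
    reversal of P_n, so the theorem says that the coefficients of these
    reversals converge.

    The polynomial Q_n = kappa_n (P_n)^*_n is the reproducing kernel at 0:
    <p, Q_n> = p(0) for deg p <= n.  Indeed conj z = 1 / z on the circle, so
    <p, q^*_n> = <q, p^*_n>, and <P_n, p^*_n> only sees the coefficient of z^n
    of p^*_n, which is conj(p(0)) ([inner_L2_reverse], [inner_L2_lead],
    [kernel0_reproducing]).  Since Q_n(0) = kappa_n^2, expanding the square
    gives, for n <= m,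

      ||Q_m - Q_n||^2 = kappa_m^2 - kappa_n^2    ([norm_kernel0B]).

    On the other side, the Rayleigh bound for the moment matrices says
    ||p||^2 >= lambda_n sum_k |p_k|^2 for deg p <= n
    ([inner_L2_lower_bound]), so a positive limit of lambda_n yields d > 0 with
    d |p_k|^2 <= ||p||^2 for every polynomial p and every k.  Hence
    d |(Q_m)_k - (Q_n)_k|^2 <= kappa_m^2 - kappa_n^2.  This makes kappa_n
    nondecreasing; it is bounded, because
    d kappa_n^4 = d |Q_n(0)|^2 <= ||Q_n||^2 = kappa_n^2.  So kappa_n^2 converges,
    each sequence (Q_n)_k is Cauchy, and b_{n-k,n} = conj((Q_n)_k) / kappa_n
    converges, the limit of kappa_n being at least kappa_0 > 0. *)

Set Implicit Arguments.
Unset Strict Implicit.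
Unset Printing Implicit Defensive.

Import Order.TTheory GRing.Theory Num.Theory.
Import numFieldNormedType.Exports.

Local Open Scope classical_set_scope.
Local Open Scope ring_scope.
Local Open Scope complex_scope.
Local Open Scope sesquilinear_scope.
(* Reopened last so that the star exponent denotes [Num.conj], to which the
   generic conjugation lemmas apply. *)
Local Open Scope ring_scope.

(** * Two general facts *)

(** [limn] of a divergent real sequence is the default value 0. *)
Lemma limn_gt0_cvg (R : realType) (u : nat -> R) : 0 < limn u -> cvgn u.
Proof.
apply: contraPP => /(@dvgP _ (u @ \oo)) ->.
by rewrite ltxx.
Qed.

(** In coordinates with respect to a unitary eigenbasis, the Hermitian form is a
    diagonal sum of squares weighted by the eigenvalues. *)
Lemma rayleigh_lower_bound (C : numClosedFieldType) n (A : 'M[C]_n) (l : C) :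
    A \is hermsymmx -> (forall a, eigenvalue A a -> l <= a) ->
  forall v : 'rV[C]_n,
    l * (\sum_i `|v 0 i| ^+ 2) <= (v *m A *m (v ^t* )) 0 0.
Proof.
move=> /hermitian_normalmx/orthomx_spectralP; set P := spectralmx A.
set d := spectral_diag A => defA l_le v.
have Pu : P \is unitarymx := spectral_unitarymx A.
have Punit := unitarymx_unit Pu.
have d_ge i : l <= d 0 i.
  apply: l_le; apply/eigenvalueP; exists (delta_mx 0 i *m P).
    rewrite {1}defA !mulmxA mulmxK// scalemxAl; congr (_ *m P).
    by rewrite -rowE row_diag_mx.
  rewrite mulmx_free_eq0 ?row_free_unit//.
  apply/eqP => /matrixP/(_ 0 i)/eqP; rewrite !mxE !eqxx.
  by rewrite oner_eq0.
pose w := v *m invmx P.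
have wE : w ^t* = P *m v ^t*.
  rewrite /w invmx_unitary// trmx_mul map_mxM; congr (_ *m _).
  exact: trmxCK.
have normE (u : 'rV[C]_n) : \sum_i `|u 0 i| ^+ 2 = (u *m u ^t* ) 0 0.
  by rewrite mxE; apply: eq_bigr => i _; rewrite normCK !mxE.
have -> : \sum_i `|v 0 i| ^+ 2 = \sum_i `|w 0 i| ^+ 2.
  by rewrite !normE wE /w mulmxA mulmxKV.
rewrite {1}defA !mulmxA -(mulmxA _ P) -/w -wE mulr_sumr mxE.
apply: ler_sum => i _; rewrite mul_mx_diag !mxE mulrAC -normCK mulrC.
by rewrite ler_wpM2l ?exprn_ge0.
Qed.

Lemma conjC_real (R : rcfType) (x : R) : (x%:C)^* = x%:C.
Proof. exact: conjc_real. Qed.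

(** * Integration against a measure carried by the unit circle *)

Section CircleIntegral.
Variables (R : realType) (nu : {finite_measure set (R * R)%type -> \bar R}).
Hypothesis hsupp : supported_on_circle nu.
Local Notation C := R[i].

(** A convenient algebra of functions that contains the products
    p(z) conj(q(z)) and consists of integrable functions: boundedness is only
    asked on the circle because polynomials are unbounded on the plane. *)
Definition circle_bounded (f : C -> C) :=
  [/\ measurable_fun setT (fun p : R * R => complex.Re (f (toC p))),
      measurable_fun setT (fun p : R * R => complex.Im (f (toC p))) &
      exists M : R, forall z : C, `|z| = 1 -> `|f z| <= M%:C].

Lemma circle_bounded_cst c : circle_bounded (fun=> c).
Proof.
split; try exact: measurable_cst.
by exists (complex.Re `|c|) => z _; rewrite RRe_real// normr_real.
Qed.

Lemma circle_bounded_id : circle_bounded id.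
Proof.
split; [exact: measurable_fst|exact: measurable_snd|].
by exists 1 => z ->.
Qed.

Lemma circle_boundedD f g : circle_bounded f -> circle_bounded g ->
  circle_bounded (fun z => f z + g z).
Proof.
move=> [f1 f2 [M fM]] [g1 g2 [N gN]]; split.
- rewrite (_ : (fun _ => _) = (fun p =>
     complex.Re (f (toC p)) + complex.Re (g (toC p)))).
    exact: measurable_funD.
  by apply/funext => p; case: (f _) (g _) => [? ?] [].
- rewrite (_ : (fun _ => _) = (fun p =>
     complex.Im (f (toC p)) + complex.Im (g (toC p)))).
    exact: measurable_funD.
  by apply/funext => p; case: (f _) (g _) => [? ?] [].
- exists (M + N) => z z1; rewrite rmorphD (le_trans (ler_normD _ _))//.
  by rewrite lerD ?fM ?gN.
Qed.

Lemma circle_boundedM f g : circle_bounded f -> circle_bounded g ->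
  circle_bounded (fun z => f z * g z).
Proof.
move=> [f1 f2 [M fM]] [g1 g2 [N gN]]; split.
- rewrite (_ : (fun _ => _) = (fun p =>
     complex.Re (f (toC p)) * complex.Re (g (toC p)) -
     complex.Im (f (toC p)) * complex.Im (g (toC p)))).
    by apply: measurable_funB; exact: measurable_funM.
  by apply/funext => p; case: (f _) (g _) => [? ?] [].
- rewrite (_ : (fun _ => _) = (fun p =>
     complex.Re (f (toC p)) * complex.Im (g (toC p)) +
     complex.Im (f (toC p)) * complex.Re (g (toC p)))).
    by apply: measurable_funD; exact: measurable_funM.
  by apply/funext => p; case: (f _) (g _) => [? ?] [].
- exists (M * N) => z z1; rewrite rmorphM normrM.
  by rewrite ler_pM ?fM ?gN.
Qed.

Lemma circle_bounded_conj f : circle_bounded f ->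
  circle_bounded (fun z => (f z)^*).
Proof.
move=> [f1 f2 [M fM]]; split.
- by rewrite (_ : (fun _ => _) = (fun p => complex.Re (f (toC p))))//;
    apply/funext => p; case: (f _).
- rewrite (_ : (fun _ => _) = (fun p => - complex.Im (f (toC p)))).
    exact: measurableT_comp.
  by apply/funext => p; case: (f _).
- by exists M => z z1; rewrite norm_conjC fM.
Qed.

Lemma circle_bounded_horner (p : {poly C}) : circle_bounded (horner p).
Proof.
elim/poly_ind: p => [|p c IH].
  rewrite (_ : horner 0 = fun=> 0); first exact: circle_bounded_cst.
  by apply/funext => z; rewrite horner0.
rewrite (_ : horner _ = fun z => p.[z] * z + c); last first.
  by apply/funext => z; rewrite hornerMXaddC.
apply: circle_boundedD; last exact: circle_bounded_cst.
by apply: circle_boundedM => //; exact: circle_bounded_id.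
Qed.

Lemma circle_bounded_prod (p q : {poly C}) :
  circle_bounded (fun z => p.[z] * (q.[z])^*).
Proof.
apply: circle_boundedM; first exact: circle_bounded_horner.
exact/circle_bounded_conj/circle_bounded_horner.
Qed.

Lemma measurable_unit_circle : measurable (@unit_circle R).
Proof.
have mf : measurable_fun setT (fun p : R * R => p.1 ^+ 2 + p.2 ^+ 2).
  by apply: measurable_funD; apply: measurable_funX;
    [exact: measurable_fst|exact: measurable_snd].
suff -> : @unit_circle R =
    setT `&` (fun p => p.1 ^+ 2 + p.2 ^+ 2) @^-1` [set 1].
  exact: mf.
rewrite setTI; apply/seteqP; split => p; rewrite /unit_circle /= normc_def /=.
  by move=> [] e; rewrite -[LHS]sqr_sqrtr ?e ?expr1n// addr_ge0 ?sqr_ge0.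
by move=> ->; rewrite sqrtr1.
Qed.

Lemma ae_circle (f : R * R -> Prop) :
  (forall p, @unit_circle R p -> f p) -> {ae nu, forall p, f p}.
Proof.
move=> fp; exists (~` @unit_circle R); split => //.
  apply: measurableC; exact: measurable_unit_circle.
by move=> p /= nfp /fp.
Qed.

Lemma eq_integral_circle (f g : R * R -> R) : measurable_fun setT f ->
  measurable_fun setT g -> (forall p, unit_circle p -> f p = g p) ->
  \int[nu]_p f p = \int[nu]_p g p.
Proof.
move=> mf mg fg; congr fine; apply: ae_eq_integral => //.
- exact/measurable_EFinP.
- exact/measurable_EFinP.
- by apply: ae_circle => p /fg /= ->.
Qed.

Lemma integrable_circle (f : R * R -> R) (M : R) : measurable_fun setT f ->
  (forall p, unit_circle p -> `|f p| <= M) -> nu.-integrable setT (EFin \o f).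
Proof.
move=> mf fM; apply/(@negligible_integrable _ _ _ _ _ (~` @unit_circle R)) => //.
- apply: measurableC; exact: measurable_unit_circle.
- exact/measurable_EFinP.
- rewrite setTD setCK; apply: measurable_bounded_integrable.
  + exact: measurable_unit_circle.
  + by rewrite ltey_eq fin_num_measure//; exact: measurable_unit_circle.
  + exact: measurable_funS mf.
  + exists M; split; first exact: num_real.
    by move=> N MN p /= /fM /le_trans; apply; exact: ltW.
Qed.

Lemma integrable_Re f : circle_bounded f ->
  nu.-integrable setT (EFin \o (fun p => complex.Re (f (toC p)))).
Proof.
move=> [f1 f2 [M fM]]; apply: (@integrable_circle _ M) => // p /fM.
by rewrite -lecR; apply: le_trans; exact: normc_ge_Re.
Qed.

Lemma integrable_Im f : circle_bounded f ->
  nu.-integrable setT (EFin \o (fun p => complex.Im (f (toC p)))).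
Proof.
move=> [f1 f2 [M fM]]; apply: (@integrable_circle _ M) => // p /fM.
rewrite -lecR; apply: le_trans.
rewrite -normrN -ReiNIm (le_trans (normc_ge_Re _))// normrM.
by rewrite (normc_def 'i%C) /= expr0n add0r expr1n sqrtr1 mulr1.
Qed.

(** This is where the support hypothesis enters the algebra: identities such as
    z conj z = 1 can be used under the integral. *)
Lemma eq_Cintegral f g : circle_bounded f -> circle_bounded g ->
  (forall z, `|z| = 1 -> f z = g z) -> Cintegral nu f = Cintegral nu g.
Proof.
move=> [f1 f2 _] [g1 g2 _] fg; rewrite /Cintegral.
by congr (_ +i* _); apply: eq_integral_circle => // p /fg ->.
Qed.

Lemma CintegralD f g : circle_bounded f -> circle_bounded g ->
  Cintegral nu (fun z => f z + g z) = Cintegral nu f + Cintegral nu g.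
Proof.
move=> fb gb; rewrite /Cintegral; apply/eqP; rewrite eq_complex /=.
rewrite -!RintegralD//;
  try solve [exact: integrable_Re | exact: integrable_Im].
by apply/andP; split; apply/eqP; apply: eq_Rintegral => p _;
  case: (f _) (g _) => [? ?] [].
Qed.

Lemma CintegralZ c f : circle_bounded f ->
  Cintegral nu (fun z => c * f z) = c * Cintegral nu f.
Proof.
move=> fb; rewrite /Cintegral; case: c => a b; apply/eqP; rewrite eq_complex /=.
have fRe := integrable_Re fb; have fIm := integrable_Im fb.
have iZ (r : R) (g : R * R -> R) : nu.-integrable setT (EFin \o g) ->
    nu.-integrable setT (EFin \o (fun p => r * g p)).
  by move=> gi; rewrite (_ : _ \o _ = (fun p => r%:E * (EFin \o g) p)%E)//;
    exact: integrableZl.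
rewrite -!RintegralZl// -RintegralB//; try exact: iZ.
rewrite -RintegralD//; try exact: iZ.
by apply/andP; split; apply/eqP; apply: eq_Rintegral => p _; case: (f _).
Qed.

Lemma CintegralJ f : circle_bounded f ->
  Cintegral nu (fun z => (f z)^*) = (Cintegral nu f)^*.
Proof.
move=> fb; rewrite /Cintegral; apply/eqP; rewrite eq_complex /=.
have fIm := integrable_Im fb.
rewrite -[X in _ && (_ == X)]mulN1r -RintegralZl//.
by apply/andP; split; apply/eqP; apply: eq_Rintegral => p _;
  case: (f _) => a b //=;
  rewrite mulN1r.
Qed.

(** * The sesquilinear form on polynomials *)

Local Notation B := (inner_L2 nu).

Lemma inner_L2C p q : B q p = (B p q)^*.
Proof.
rewrite /inner_L2 -CintegralJ; last exact: circle_bounded_prod.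
by congr Cintegral; apply/funext => z; rewrite rmorphM /= conjCK mulrC.
Qed.

Lemma inner_L2Dl p q r : B (p + q) r = B p r + B q r.
Proof.
rewrite /inner_L2 -CintegralD; try exact: circle_bounded_prod.
by congr Cintegral; apply/funext => z; rewrite hornerD mulrDl.
Qed.

Lemma inner_L2Zl c p q : B (c *: p) q = c * B p q.
Proof.
rewrite /inner_L2 -CintegralZ; last exact: circle_bounded_prod.
by congr Cintegral; apply/funext => z; rewrite hornerZ mulrA.
Qed.

Lemma inner_L2Bl p q r : B (p - q) r = B p r - B q r.
Proof. by rewrite -scaleN1r inner_L2Dl inner_L2Zl mulN1r. Qed.

Lemma inner_L2Zr c p q : B p (c *: q) = c^* * B p q.
Proof. by rewrite inner_L2C inner_L2Zl rmorphM [in RHS]inner_L2C. Qed.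

Lemma inner_L2Br p q r : B p (q - r) = B p q - B p r.
Proof.
by rewrite inner_L2C inner_L2Bl rmorphB [B p q]inner_L2C [B p r]inner_L2C.
Qed.

Lemma inner_L2_suml n q (F : 'I_n -> {poly C}) :
  B (\sum_i F i) q = \sum_i B (F i) q.
Proof.
apply: (big_morph (fun p => B p q)) => [p r|]; first exact: inner_L2Dl.
by rewrite -[0](scale0r 0) inner_L2Zl mul0r.
Qed.

Lemma inner_L2_sumr n p (F : 'I_n -> {poly C}) :
  B p (\sum_i F i) = \sum_i B p (F i).
Proof.
rewrite inner_L2C inner_L2_suml rmorph_sum; apply: eq_bigr => i _.
by rewrite [RHS]inner_L2C.
Qed.

Lemma inner_L2Xn i j : B 'X^i 'X^j = moment nu i j.
Proof.
by congr Cintegral; apply/funext => z; rewrite !hornerXn rmorphXn.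
Qed.

Lemma inner_L2_moment n (p : {poly C}) : (size p <= n.+1)%N ->
  B p p = \sum_(i < n.+1) \sum_(j < n.+1) p`_i * (p`_j)^* * moment nu i j.
Proof.
move=> sp; have e : p = \sum_(i < n.+1) p`_i *: 'X^i.
  rewrite -poly_def; apply/polyP => k; rewrite coef_poly; case: ltnP => // nk.
  by rewrite nth_default// (leq_trans sp).
rewrite [X in B X _]e inner_L2_suml; apply: eq_bigr => i _.
rewrite [X in B _ X]e inner_L2_sumr; apply: eq_bigr => j _.
by rewrite inner_L2Zl inner_L2Zr inner_L2Xn mulrA.
Qed.

Lemma moment_mx_hermitian n : moment_mx nu n \is hermsymmx.
Proof.
apply/is_hermitianmxP; rewrite expr0 scale1r; apply/matrixP => i j.
by rewrite !mxE -!inner_L2Xn inner_L2C.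
Qed.

(** The moment matrix is the Gram matrix of the monomials, so the Rayleigh bound
    compares the L^2 norm of p with the l^2 norm of its coefficients, and in
    particular with each single coefficient. *)
Lemma inner_L2_lower_bound n (l : R) (p : {poly C}) k :
    smallest_eigenvalue (moment_mx nu n) l -> 0 <= l -> (size p <= n.+1)%N ->
  l%:C * `|p`_k| ^+ 2 <= B p p.
Proof.
move=> [_ l_le] l0 sp.
have := rayleigh_lower_bound (moment_mx_hermitian n) l_le (\row_i p`_i).
have -> : (\row_i p`_i *m moment_mx nu n *m (\row_i p`_i) ^t* ) 0 0 = B p p.
  rewrite (inner_L2_moment sp) exchange_big mxE; apply: eq_bigr => j _.
  rewrite !mxE mulr_suml; apply: eq_bigr => i _.
  by rewrite !mxE mulrAC.
apply: le_trans; rewrite ler_wpM2l ?ler0c//.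
have [kn|nk] := ltnP k n.+1; last first.
  rewrite nth_default ?(leq_trans sp)// normr0 expr0n.
  by apply: sumr_ge0 => i _; rewrite exprn_ge0.
rewrite (bigD1 (Ordinal kn)) //= mxE ler_wpDr//.
by apply: sumr_ge0 => i _; rewrite exprn_ge0.
Qed.

(** The reversed polynomial z^n conj(p(1 / conj z)) of the theory of orthogonal
    polynomials on the circle. *)
Definition reverse n (p : {poly C}) : {poly C} :=
  \poly_(i < n.+1) (p`_(n - i))^*.

Lemma coef_reverse n p k : (k <= n)%N -> (reverse n p)`_k = (p`_(n - k))^*.
Proof. by move=> kn; rewrite coef_poly ltnS kn. Qed.

Lemma size_reverse n p : (size (reverse n p) <= n.+1)%N.
Proof. exact: size_poly. Qed.

Lemma horner_reverse n (p : {poly C}) z : `|z| = 1 -> (size p <= n.+1)%N ->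
  (reverse n p).[z] = z ^+ n * (p.[z])^*.
Proof.
move=> z1 sp; rewrite horner_poly (horner_coef_wide _ sp) rmorph_sum /= mulr_sumr.
rewrite (reindex_inj rev_ord_inj) /=; apply: eq_bigr => i _.
have le_in : (i <= n)%N by rewrite -ltnS.
rewrite subSS subKn// rmorphM rmorphXn /= mulrCA; congr (_ * _).
have zz : z * z^* = 1 by rewrite -normCK z1 expr1n.
have -> : z ^+ n = z ^+ (n - i) * z ^+ i by rewrite -exprD subnK.
by rewrite -mulrA -exprMn zz expr1n mulr1.
Qed.

(** Both sides are the integral of p(z) q(z) conj(z)^n. *)
Lemma inner_L2_reverse n (p q : {poly C}) :
    (size p <= n.+1)%N -> (size q <= n.+1)%N ->
  B p (reverse n q) = B q (reverse n p).
Proof.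
move=> sp sq; apply: eq_Cintegral; try exact: circle_bounded_prod.
move=> z z1; rewrite !horner_reverse// !rmorphM /= !conjCK.
by rewrite mulrCA [RHS]mulrCA [_.[z] * _]mulrC.
Qed.

(** * Orthonormal polynomials and the reproducing kernel at the origin *)

Section Orthonormal.
Variables (P : nat -> {poly C}) (hP : orthonormal_polys nu P).

Let sizeP n : size (P n) = n.+1.
Proof. by have [/(_ n)[]] := hP. Qed.

Definition kappa n : R := complex.Re (P n)`_n.

Lemma kappaE n : (P n)`_n = (kappa n)%:C.
Proof.
by have [/(_ n)[_ /gtr0_real/RRe_real]] := hP.
Qed.

Lemma kappa_gt0 n : 0 < kappa n.
Proof. by rewrite -ltcR -kappaE; have [/(_ n)[]] := hP. Qed.

Lemma kappa_neq0 n : (kappa n)%:C != 0.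
Proof. by rewrite gt_eqF// ltcR kappa_gt0. Qed.

Lemma size_sub_lead n (p : {poly C}) : (size p <= n.+1)%N ->
  (size (p - (p`_n / (kappa n)%:C) *: P n)%R <= n)%N.
Proof.
move=> sp; apply/leq_sizeP => j; rewrite leq_eqVlt => /predU1P[<-|nj].
  by rewrite coefB coefZ kappaE mulfVK ?subrr ?kappa_neq0.
by rewrite nth_default// (leq_trans (size_polyD _ _))// size_polyN geq_max
  (leq_trans sp)//= (leq_trans (size_scale_leq _ _))// sizeP.
Qed.

(** Induction on the size bound: subtracting a multiple of P_m kills the leading
    term, and P_m is orthogonal to P_n. *)
Lemma inner_L2_lower n m (p : {poly C}) : (m <= n)%N -> (size p <= m)%N ->
  B p (P n) = 0.
Proof.
elim: m p => [|m IH] p mn sp.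
  move: sp; rewrite leqn0 size_poly_eq0 => /eqP ->.
  by rewrite -[0](scale0r 0) inner_L2Zl mul0r.
have := IH _ (ltnW mn) (size_sub_lead sp).
rewrite inner_L2Bl inner_L2Zl; have [_ ->] := hP.
by rewrite ltn_eqF// mulr0 subr0.
Qed.

(** Modulo polynomials of lower degree, which are orthogonal to P_n, the
    polynomial p is a multiple of P_n. *)
Lemma inner_L2_lead n (p : {poly C}) : (size p <= n.+1)%N ->
  B p (P n) = p`_n / (kappa n)%:C.
Proof.
move=> /size_sub_lead/(inner_L2_lower (leqnn n)).
rewrite inner_L2Bl inner_L2Zl; have [_ ->] := hP.
by rewrite eqxx mulr1 => /eqP; rewrite subr_eq0 => /eqP.
Qed.

(** The polynomial that represents evaluation at 0 on polynomials of degree at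
    most n; it equals sum_(j <= n) conj(P_j(0)) P_j. *)
Definition kernel0 n : {poly C} := (kappa n)%:C *: reverse n (P n).

(** Reversal turns the product with (P_n)^* into a product with P_n, which only
    sees the coefficient of degree n of p^*, that is, the conjugate of p(0). *)
Lemma kernel0_reproducing n (p : {poly C}) : (size p <= n.+1)%N ->
  B p (kernel0 n) = p`_0.
Proof.
move=> sp; rewrite inner_L2Zr conjC_real inner_L2_reverse ?sizeP//.
rewrite inner_L2C inner_L2_lead ?size_reverse// coef_reverse// subnn.
by rewrite rmorphM fmorphV /= conjCK conjC_real mulrCA divff ?mulr1// kappa_neq0.
Qed.

Lemma size_kernel0 n : (size (kernel0 n) <= n.+1)%N.
Proof. by rewrite (leq_trans (size_scale_leq _ _))// size_reverse. Qed.

Lemma coef_kernel0 n k : (k <= n)%N ->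
  (kernel0 n)`_k = (kappa n)%:C * ((P n)`_(n - k))^*.
Proof. by move=> kn; rewrite coefZ coef_reverse. Qed.

Lemma kernel0_at0 n : (kernel0 n)`_0 = (kappa n ^+ 2)%:C.
Proof.
by rewrite coef_kernel0// subn0 kappaE conjC_real -rmorphM -expr2.
Qed.

(** Q_n and Q_m both have degree at most m, so three of the four terms of the
    expanded square are values at 0 of kernels by the reproducing property of
    Q_m or of Q_n; the remaining <Q_m, Q_n> follows by conjugate symmetry. *)
Lemma norm_kernel0B m n : (n <= m)%N ->
  B (kernel0 m - kernel0 n) (kernel0 m - kernel0 n) =
  (kappa m ^+ 2 - kappa n ^+ 2)%:C.
Proof.
move=> nm; have sn := size_kernel0 n; have sm := size_kernel0 m.
have snm : (size (kernel0 n) <= m.+1)%N by rewrite (leq_trans sn).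
rewrite inner_L2Bl !inner_L2Br.
rewrite (inner_L2C (kernel0 n)) !kernel0_reproducing// !kernel0_at0 conjC_real.
by rewrite subrr subr0 rmorphB.
Qed.

End Orthonormal.

End CircleIntegral.

(** * Convergence of sequences *)

(** The increments of x are controlled by those of a convergent sequence,
    so x is Cauchy. *)
Lemma cvgn_of_sqr_le (R : realType) (d : R) (s x : nat -> R) : 0 < d ->
    nondecreasing_seq s -> cvgn s ->
    (forall n m, (n <= m)%N -> d * (x m - x n) ^+ 2 <= s m - s n) ->
  cvgn x.
Proof.
move=> d0 s_nd s_cvg xs; apply/cauchy_cvgP/cauchy_exP => _/posnumP[e].
have de0 : 0 < d * e%:num ^+ 2 by rewrite mulr_gt0 ?exprn_gt0.
have /cvgrPdist_lt/(_ _ de0)[N _ sN] := s_cvg.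
(* the centre x N works since s m - s N <= lim s - s N for all m >= N *)
exists (x N); exists N => // m /= Nm; rewrite /ball /= distrC.
rewrite -(ltr_pXn2r (n := 2)) ?nnegrE// -(ltr_pM2l d0) real_normK ?num_real//.
apply: le_lt_trans (xs _ _ Nm) _; apply: le_lt_trans (sN N (leqnn N)).
rewrite (le_trans _ (ler_norm _))// lerD2r.
exact: nondecreasing_cvgn_le.
Qed.

Lemma norm_real_complex (R : rcfType) (x : R) : `|x%:C| = `|x|%:C.
Proof. by rewrite normc_def /= expr0n addr0 sqrtr_sqr. Qed.

Lemma cvgn_complex (R : realType) (x y : nat -> R) : cvgn x -> cvgn y ->
  cvgn (fun n => x n +i* y n : R[i]^o).
Proof.
move=> x_cvg y_cvg; apply/cvg_ex; exists (limn x +i* limn y).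
apply/cvgrPdist_lt => e e0.
have eE : e = (complex.Re e)%:C by rewrite RRe_real ?gtr0_real.
have r0 : 0 < complex.Re e / 2 by rewrite divr_gt0// -ltcR -eE.
near=> n.
rewrite eE [complex.Re e]splitr rmorphD /= [X in `|X|]complexE.
rewrite (le_lt_trans (ler_normD _ _))// normrM complexiE normCi mul1r.
rewrite !norm_real_complex.
apply: ltrD; rewrite ltcR.
- by near: n; move/cvgrPdist_lt : x_cvg; apply.
- by near: n; move/cvgrPdist_lt : y_cvg; apply.
Unshelve. all: by end_near. Qed.

(** * Convergence of the top coefficients *)

Section Coercive.
Variables (R : realType) (nu : {finite_measure set (R * R)%type -> \bar R}).
Hypothesis hsupp : supported_on_circle nu.
Variables (P : nat -> {poly R[i]}) (hP : orthonormal_polys nu P).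
Variables (d : R) (d0 : 0 < d).
Hypothesis coercive :
  forall (p : {poly R[i]}) k, d%:C * `|p`_k| ^+ 2 <= inner_L2 nu p p.

Local Notation kappa := (kappa P).
Local Notation Q := (kernel0 P).

(** The square of the modulus is split into real and imaginary parts because
    convergence is established for real sequences. *)
Lemma coef_kernel0B n m k : (n <= m)%N ->
  d * (complex.Re (Q m)`_k - complex.Re (Q n)`_k) ^+ 2 +
  d * (complex.Im (Q m)`_k - complex.Im (Q n)`_k) ^+ 2 <=
  kappa m ^+ 2 - kappa n ^+ 2.
Proof.
move=> nm; rewrite -lecR -(norm_kernel0B hsupp hP nm).
apply: le_trans (coercive _ k); rewrite -add_Re2_Im2 -rmorphM lecR mulrDr coefB.
by case: ((Q m)`_k) ((Q n)`_k) => [? ?] [].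
Qed.

Lemma kappa_ge0 n : 0 <= kappa n.
Proof. exact: ltW (kappa_gt0 hP n). Qed.

Lemma kappa_le n m : (n <= m)%N -> kappa n <= kappa m.
Proof.
move=> nm; rewrite -(ler_pXn2r (n := 2)) ?nnegrE ?kappa_ge0// -subr_ge0.
apply: le_trans (coef_kernel0B 0 nm).
by rewrite -mulrDr mulr_ge0 ?addr_ge0 ?sqr_ge0 ?(ltW d0).
Qed.

(** Coercivity applied to the coefficient 0 of Q_n, for which both sides are
    powers of kappa_n: d kappa_n^4 <= kappa_n^2. *)
Lemma kappa_sqr_bounded n : kappa n ^+ 2 <= d^-1.
Proof.
have := coercive (Q n) 0.
rewrite (kernel0_reproducing hsupp hP (size_kernel0 P n)) (kernel0_at0 hP).
rewrite norm_real_complex -rmorphXn -rmorphM lecR.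
rewrite ger0_norm ?sqr_ge0// [_ ^+ 2 ^+ 2]expr2 mulrA.
by rewrite ger_pMl ?exprn_gt0 ?(kappa_gt0 hP)// -ler_pdivlMl// mulr1.
Qed.

Lemma kappa_cvg : cvgn kappa.
Proof.
apply: nondecreasing_is_cvgn; first by move=> n m; exact: kappa_le.
(* kappa_n <= max(1, kappa_n^2) <= 1 + 1 / d *)
exists (1 + d^-1) => _ [n _ <-].
have [k1|k1] := leP (kappa n) 1; first by rewrite ler_wpDr ?invr_ge0 ?(ltW d0).
rewrite ler_wpDl// (le_trans _ (kappa_sqr_bounded n))//.
by rewrite ler_eXnr// ltW.
Qed.

Lemma lim_kappa_neq0 : limn kappa != 0.
Proof.
rewrite gt_eqF// (lt_le_trans (kappa_gt0 hP 0))//.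
by apply: nondecreasing_cvgn_le kappa_cvg _ => n m; exact: kappa_le.
Qed.

Lemma kappa_sqr_cvg : cvgn (fun n => kappa n ^+ 2).
Proof.
by under eq_fun do rewrite expr2; exact: is_cvgM kappa_cvg kappa_cvg.
Qed.

Lemma kappa_sqr_nd : nondecreasing_seq (fun n => kappa n ^+ 2).
Proof.
by move=> n m nm; rewrite ler_pXn2r ?nnegrE ?kappa_ge0// kappa_le.
Qed.

Lemma Re_kernel0_cvg k : cvgn (fun n => complex.Re (Q n)`_k).
Proof.
apply: (cvgn_of_sqr_le d0 kappa_sqr_nd kappa_sqr_cvg) => n m nm.
apply: le_trans (coef_kernel0B k nm).
by rewrite lerDl mulr_ge0 ?sqr_ge0 ?ltW.
Qed.

Lemma Im_kernel0_cvg k : cvgn (fun n => complex.Im (Q n)`_k).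
Proof.
apply: (cvgn_of_sqr_le d0 kappa_sqr_nd kappa_sqr_cvg) => n m nm.
apply: le_trans (coef_kernel0B k nm).
by rewrite lerDr mulr_ge0 ?sqr_ge0 ?ltW.
Qed.

Lemma coef_top_cvg k : cvgn (fun n : nat => (P n)`_(n - k)%N : R[i]^o).
Proof.
have kV : cvgn (fun n => (kappa n)^-1).
  exact: is_cvgV lim_kappa_neq0 kappa_cvg.
have Re_cvg : cvgn (fun n => complex.Re (Q n)`_k / kappa n).
  exact: is_cvgM (@Re_kernel0_cvg k) kV.
have Im_cvg : cvgn (fun n => - (complex.Im (Q n)`_k / kappa n)).
  exact: is_cvgN (is_cvgM (@Im_kernel0_cvg k) kV).
have /cvg_ex[l Hl] := cvgn_complex Re_cvg Im_cvg.
apply/cvg_ex; exists l; apply: cvg_trans Hl.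
(* for n < k the truncated index n - k is 0, so the formula needs n >= k *)
apply: near_eq_cvg; exists k => // n /= kn.
have n0 := lt0r_neq0 (kappa_gt0 hP n).
rewrite (coef_kernel0 _ kn); case: ((P n)`_(n - k)) => a b /=.
by rewrite !(mul0r, mulr0, addr0, subr0) mulrN mulNr opprK
  ![kappa n * _]mulrC !mulfK.
Qed.

End Coercive.

Theorem corollary4 (R : realType)
    (nu : {finite_measure set (R * R)%type -> \bar R})
    (hsupp : supported_on_circle nu)
    (hpos : forall n : nat, 0 < \det (moment_mx nu n))
    (lambda : nat -> R)
    (hlambda : forall n : nat, smallest_eigenvalue (moment_mx nu n) (lambda n))
    (P : nat -> {poly R[i]})
    (hP : orthonormal_polys nu P)
    (hlim : 0 < limn lambda) :
  forall k : nat, cvgn (fun n : nat => (P n)`_(n - k)%N : R[i]^o).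
Proof.
(* Half of the limit is a coercivity constant: for given p take an index n large
   enough that both deg p <= n and lambda n exceeds it. *)
have lambda_cvg : lambda @ \oo --> limn lambda := limn_gt0_cvg hlim.
have d0 : 0 < limn lambda / 2 by rewrite divr_gt0.
apply: (coef_top_cvg hsupp hP d0) => p k.
have half : limn lambda / 2 < limn lambda.
  by rewrite ltr_pdivrMr// ltr_pMr// ltr1n.
have [N _ lambdaN] := cvgr_gt _ lambda_cvg _ half.
pose n := maxn N (size p).
have ln : limn lambda / 2 < lambda n := lambdaN n (leq_maxl _ _).
have := inner_L2_lower_bound hsupp k (hlambda n) (ltW (lt_trans d0 ln)).
move=> /(_ p (leq_trans (leq_maxr N _) (leqnSn _))); apply: le_trans.
by rewrite ler_wpM2r ?exprn_ge0// lecR ltW.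
Qed.
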